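(* Let $Y$ be a finite, non-empty subset of $\mathbb{N}$, let $f>6Max(Y)+6$ be an integer, and let $Z$ be a subset of $[0,Max(Y)]$ such that $Z\cap Y=\emptyset$. If $f$ is odd then $$N(Y,Z,f)=2^{\overline{f}-Max(Y)-1-\alpha},$$ $$N(Y,Z,f,n)={\overline{f}-Max(Y)-1-\alpha\choose n-Max(Y)-1-\alpha+\beta}.$$ If $f$ is even then the same formulas hold with $\alpha$ replaced by $\alpha'$.
   Context: A numerical semigroup is a subset $S\subseteq\mathbb{N}=\{0,1,2,\dots\}$ that contains $0$, is closed under addition, and has finite complement in $\mathbb{N}$. The Frobenius number $f(S)$ is the largest element of $\mathbb{N}\setminus S$, the multiplicity $m(S)$ is the smallest non-zero element of $S$, and $n(S)=|S\cap[1,f(S)]|$. The depth of $S$ is $q(S)=\left\lceil\frac{f(S)+1}{m(S)}\right\rceil$. For a positive integer $f$, $\overline{f}=\left\lfloor\frac{f-1}{2}\right\rfloor$. Intervals are intervals of integers: $[a,b]=\{k\in\mathbb{Z}\mid a\le k\le b\}$. For a numerical semigroup $S$ with Frobenius number $f$ let $$Y(S)=\{t\mid \overline{f}-t\in S,\ 0\le t<\overline{f}\}.$$ For $S$ of depth $3$ let $$Z(S)=\left\{x-f(S)+\overline{f(S)}\ \middle|\ x\in S,\ \tfrac{f(S)}{2}<x\le f(S)-m(S)\right\}.$$ (If $Y(S)=Y\ne\emptyset$ and $f(S)>6Max(Y)+6$, then $S$ has depth $3$.) $Max(Y)$ is the largest element of $Y$. $N(Y,Z,f)$ is the number of numerical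 semigroups $S$ with Frobenius number $f$, $Y(S)=Y$ and $Z(S)=Z$; $N(Y,Z,f,n)$ is the number of those with, in addition, $n(S)=n$. For sets of integers $A,B$: $2A=\{x+y\mid x,y\in A\}$, $A-B=\{x-y\mid x\in A,y\in B\}$, and $A-B-k=\{x-y-k\mid x\in A,y\in B\}$. Put $$W_1(Y,Z)=(Y-Z-1)\cap[0,\infty),\qquad W_2(Y,Z)=(Y-Z-2)\cap[-1,\infty),$$ $$\alpha=|2Y\cup W_1(Y,Z)|,\qquad \alpha'=|2Y\cup W_2(Y,Z)|,\qquad \beta=Max(Y)+1-|Y\cup Z|.$$ Binomial coefficients $\binom{a}{b}$ with $b<0$ or $b>a$ are $0$. *)

(* Defs.v *)
From HB Require Import structures.
From mathcomp Require Import all_boot all_order all_algebra finmap.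
From mathcomp Require Import boolp classical_sets functions cardinality.

Set Implicit Arguments.
Unset Strict Implicit.
Unset Printing Implicit Defensive.

Import Order.TTheory GRing.Theory Num.Theory.
Local Open Scope classical_set_scope.
Local Open Scope ring_scope.

(* The cardinality of a finite set; the value on infinite sets is 0. *)
Definition card_of (T : choiceType) (A : set T) : nat := #|` fset_set A |%fset.

(* The value is 0 when there is no largest (resp. smallest) element. *)
Definition set_max (A : set nat) : nat :=
  xget 0%N [set x | A x /\ forall y, A y -> (y <= x)%N].
Definition set_min (A : set nat) : nat :=
  xget 0%N [set x | A x /\ forall y, A y -> (x <= y)%N].

Definition numerical_semigroup (S : set nat) : Prop :=
  [/\ S 0%N, (forall x y, S x -> S y -> S (x + y)%N) & finite_set (~` S)].

(* By the convention on set_max, frobenius setT = 0 instead of -1. *)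
Definition frobenius (S : set nat) : nat := set_max (~` S).

Definition multiplicity (S : set nat) : nat := set_min [set x | S x /\ x <> 0%N].

Definition nsmall (S : set nat) : nat :=
  card_of [set x | S x /\ (1 <= x <= frobenius S)%N].

Definition depth (S : set nat) : int :=
  Num.ceil ((frobenius S + 1)%N%:R / (multiplicity S)%:R : rat).

Definition fbar (f : nat) : nat := ((f - 1) %/ 2)%N.

Definition Yset (S : set nat) : set nat :=
  [set t | (t < fbar (frobenius S))%N /\ S (fbar (frobenius S) - t)%N].

(* f(S)/2 < x implies f(S) <= x + fbar (f(S)), so the subtraction of natural
   numbers does not truncate. *)
Definition Zset (S : set nat) : set nat :=
  [set (x + fbar (frobenius S) - frobenius S)%N | x in
    [set x | [/\ S x, (frobenius S < 2 * x)%N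
               & (x + multiplicity S <= frobenius S)%N]]].

(* Z(S) is only defined for S of depth 3, hence the condition on the depth. *)
Definition semigroups (Y Z : set nat) (f : nat) : set (set nat) :=
  [set S | [/\ numerical_semigroup S, frobenius S = f, Yset S = Y,
               depth S = 3 & Zset S = Z]].

Definition N_YZf (Y Z : set nat) (f : nat) : nat := card_of (semigroups Y Z f).

Definition N_YZfn (Y Z : set nat) (f n : nat) : nat :=
  card_of [set S | semigroups Y Z f S /\ nsmall S = n].

Definition sumset (A B : set nat) : set int :=
  [set x%:Z + y%:Z | x in A & y in B].

Definition diffset (A B : set nat) (k : int) : set int :=
  [set x%:Z - y%:Z - k | x in A & y in B].

Definition W1 (Y Z : set nat) : set int := diffset Y Z 1 `&` [set k | 0 <= k].
Definition W2 (Y Z : set nat) : set int := diffset Y Z 2 `&` [set k | -1 <= k].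

Definition alpha (Y Z : set nat) : int := (card_of (sumset Y Y `|` W1 Y Z))%:Z.
Definition alpha' (Y Z : set nat) : int := (card_of (sumset Y Y `|` W2 Y Z))%:Z.
Definition beta (Y Z : set nat) : int :=
  (set_max Y)%:Z + 1 - (card_of (Y `|` Z))%:Z.

(* Binomial coefficient with integer arguments, 0 if b < 0 or b > a. *)
Definition binz (a b : int) : nat :=
  match a, b with
  | Posz m, Posz k => 'C(m, k)
  | _, _ => 0%N
  end.

(* Main.v *)
(* Write F = fbar f, M = Max(Y) and f = 2F + 1 + e with e in {0, 1}. Then S has
   multiplicity F - M and is determined up to f - (F - M) = F + 1 + e + M by Y and
   Z: below f/2 it consists of 0 and the F - t with t in Y, above f/2 of the
   F + 1 + e + z with z in Z. Since F >= 3M + 3, every sum that does not exceed f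
   involves at most two such elements, and lies in the interval strictly between
   F + 1 + e + M and f: it is 2F - (t + u) or f - (t - z), and the latter is never f
   as Y and Z are disjoint. Via k |-> 2F - k these forced elements correspond to
   2Y together with W1 (e = 0) or W2 (e = 1), and the other elements of that
   interval of length F - M - 1 can be chosen freely. *)
Require Import Defs.
From mathcomp Require Import all_boot all_order all_algebra finmap.
From mathcomp Require Import boolp classical_sets functions cardinality.
From mathcomp Require Import zify.

Import Order.TTheory GRing.Theory Num.Theory.
Local Open Scope classical_set_scope.
Local Open Scope ring_scope.

(** * Cardinalities, maxima and minima of sets *)

Lemma card_of_image (T U : choiceType) (h : T -> U) (A : set T) :
  finite_set A -> {in A &, injective h} -> card_of (h @` A) = card_of A.
Proof.
move=> finA hinj; rewrite /card_of fset_set_image// card_in_imfset//=.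
by move=> x y; rewrite !in_fset_set// => Ax Ay; apply: hinj.
Qed.

Lemma card_of_setU (T : choiceType) (A B : set T) :
  finite_set A -> finite_set B -> A `&` B = set0 ->
  card_of (A `|` B) = (card_of A + card_of B)%N.
Proof.
move=> finA finB AB0; rewrite /card_of fset_setU// cardfsU.
by rewrite -fset_setI// AB0 fset_set0 cardfs0 subn0.
Qed.

Lemma card_of_finset (I : finType) (P : {set I}) : card_of [set` P] = #|P|.
Proof.
rewrite /card_of (_ : fset_set _ = [fset x in P]%fset) ?card_finset//.
by apply/fsetP => x; rewrite in_fset_set// !inE mem_setE.
Qed.

Lemma card_of_itv (a b : nat) :
  card_of [set x | (a < x < b)%N] = (b - a.+1)%N.
Proof.
have -> : [set x | (a < x < b)%N] =
    (fun i : 'I_(b - a.+1) => (a.+1 + i)%N) @` [set` [set: 'I_(b - a.+1)]%SET].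
  apply/seteqP; split=> [x /= xab|_ [i _ <-] /=]; last by have := ltn_ord i; lia.
  have xi : (x - a.+1 < b - a.+1)%N by lia.
  by exists (Ordinal xi) => /=; [rewrite inE | lia].
rewrite card_of_image ?card_of_finset ?cardsT ?card_ord//.
by move=> i j _ _ ij; apply: val_inj => /=; lia.
Qed.

Lemma finite_set_ltn (A : set nat) (b : nat) :
  (forall x, A x -> (x < b)%N) -> finite_set A.
Proof. by move=> Ab; apply: sub_finite_set (finite_II b). Qed.

Lemma set_max_eq (A : set nat) x :
  A x -> (forall y, A y -> (y <= x)%N) -> set_max A = x.
Proof.
move=> Ax xub; apply: xget_unique => // y [Ay yub].
by apply/eqP; rewrite eqn_leq xub// yub.
Qed.

(** A positive value is not the default 0, so a maximum exists without any finiteness assumption. *)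
Lemma set_maxP (A : set nat) : (0 < set_max A)%N ->
  A (set_max A) /\ forall y, A y -> (y <= set_max A)%N.
Proof. by rewrite /set_max; case: xgetP => [x ->//|]. Qed.

Lemma finite_set_maxP (A : set nat) : finite_set A -> A !=set0 ->
  A (set_max A) /\ forall y, A y -> (y <= set_max A)%N.
Proof.
move=> finA [x0 Ax0].
have exA : exists x, `[< A x >] by exists x0; apply/asboolP.
have ubA x : `[< A x >] -> (x <= \max_(y <- fset_set A) y)%N.
  by move/asboolP => Ax; apply: leq_bigmax_seq => //; rewrite in_fset_set ?inE.
case: (ex_maxnP exA ubA) => x /asboolP Ax xub.
have {}xub y : A y -> (y <= x)%N by move=> /asboolP; apply: xub.
by rewrite (set_max_eq _ _ Ax xub).
Qed.

Lemma set_min_eq (A : set nat) x :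
  A x -> (forall y, A y -> (x <= y)%N) -> set_min A = x.
Proof.
move=> Ax xlb; apply: xget_unique => // y [Ay ylb].
by apply/eqP; rewrite eqn_leq xlb// ylb.
Qed.

Lemma ceil_ratio_eq3 (a m : nat) : (2 * m < a <= 3 * m)%N ->
  Num.ceil (a%:R / m%:R : rat) = 3.
Proof.
move=> am; have m0 : 0 < m%:R :> rat by rewrite ltr0n; lia.
by apply: ceil_def; rewrite ltr_pdivlMr// ler_pdivrMr// -!natrM ltr_nat ler_nat.
Qed.

(** * Semigroups with prescribed Y, Z and f, for both parities at once *)

Section Structure.
Variables (Y Z : set nat) (M F e f : nat).
Hypotheses (YM : Y M) (Y_le : forall t, Y t -> (t <= M)%N).
Hypotheses (Z_le : forall z, Z z -> (z <= M)%N).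
Hypothesis YZ : forall t, Y t -> Z t -> False.
Hypotheses (fE : f = (2 * F + 1 + e)%N) (e1 : (e <= 1)%N).
Hypotheses (fbarE : fbar f = F) (F_ge : (3 * M + 3 <= F)%N).

Definition lower : set nat := (fun t => F - t)%N @` Y.

Definition middle : set nat := (fun z => F + 1 + e + z)%N @` Z.

Definition upper : set nat := [set x | (F + 1 + e + M < x < f)%N].

(** The sums (F - t) + (F - u) and (F - t) + (F + 1 + e + z), stated additively to avoid truncated
    subtraction. Only the second kind can reach f, hence its bound. *)
Definition forced : set nat :=
  [set x | (exists2 t, Y t & exists2 u, Y u & (x + t + u = 2 * F)%N) \/
           ((x < f)%N /\ exists2 t, Y t & exists2 z, Z z & (x + t = f + z)%N)].

Definition fill (A : set nat) : set nat :=
  [set x | [\/ x = 0%N \/ (f < x)%N, lower x, middle x | A x]].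

(** The critical case is 2F - 2M > F + 1 + e + M, that is F > 3M + 1 + e; for e = 1 this is exactly
    F >= 3M + 3. *)
Lemma forced_upper : forced `<=` upper.
Proof.
move=> x [[t Yt [u Yu xE]]|[xf [t Yt [z Zz xE]]]] /=; rewrite /upper /=.
  by have := Y_le _ Yt; have := Y_le _ Yu; lia.
by have := Y_le _ Yt; lia.
Qed.

Lemma lower_le x : lower x -> (F - M <= x <= F)%N.
Proof. by move=> [t /Y_le]; lia. Qed.

Lemma middle_le x : middle x -> (F + 1 + e <= x <= F + 1 + e + M)%N.
Proof. by move=> [z /Z_le]; lia. Qed.

Lemma frobenius_eq (S : set nat) :
  ~ S f -> (forall x, (f < x)%N -> S x) -> frobenius S = f.
Proof.
move=> Sf Sgt; apply: set_max_eq => // y Sy.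
by rewrite leqNgt; apply/negP => /Sgt.
Qed.

Lemma multiplicity_eq (S : set nat) :
  S (F - M)%N -> (forall x, S x -> (0 < x)%N -> (F - M <= x)%N) ->
  multiplicity S = (F - M)%N.
Proof.
move=> SFM Sge; apply: set_min_eq; first by split=> //; lia.
by move=> y [Sy y0]; apply: Sge => //; lia.
Qed.

(** Let x <= y be nonzero with x + y <= f. Then x is in [lower], since otherwise x + y >= 2(F + 1 +
    e) > f; and y is not in [upper], since (F - M) + (F + 2 + e + M) = f + 1. The remaining sums are
    in [forced]. *)
Lemma fill_closed (A : set nat) : forced `<=` A -> A `<=` upper ->
  forall x y, fill A x -> fill A y -> fill A (x + y)%N.
Proof.
move=> GA AU.
have wlg x y : (x <= y)%N -> fill A x -> fill A y -> fill A (x + y)%N.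
  move=> xy Ax Ay; have [gtf|lef] := ltnP f (x + y)%N; first by apply: Or41; right.
  case: Ax Ay => [[->|]|xl|/middle_le|/AU]; rewrite /upper /= ?add0n//; try lia.
  have [t Yt tE] := xl; have tM := Y_le _ Yt.
  case=> [[|]|yl|ym|/AU]; rewrite /upper /=; try lia.
    have [u Yu uE] := yl; have uM := Y_le _ Yu.
    by apply: Or44; apply: GA; left; exists t => //; exists u => //; lia.
  have [z Zz zE] := ym; have zM := Z_le _ Zz.
  apply: Or44; apply: GA; right; split.
    (* The sum (F - t) + (F + 1 + e + z) equals f only if t = z, which disjointness excludes. *)
    rewrite ltn_neqAle lef andbT; apply/eqP => xyf.
    by apply: (YZ _ Yt); have -> : t = z by lia.
  by exists t => //; exists z => //; lia.
move=> x y Ax Ay; have [xy|/ltnW yx] := leqP x y; first exact: wlg.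
by rewrite addnC; apply: wlg.
Qed.

Lemma fill_nf (A : set nat) : A `<=` upper -> ~ fill A f.
Proof.
by move=> AU [[|]|/lower_le|/middle_le|/AU]; rewrite /upper /=; lia.
Qed.

Lemma frobenius_fill (A : set nat) : A `<=` upper -> frobenius (fill A) = f.
Proof.
by move=> AU; apply: frobenius_eq _ (fill_nf _ AU) _ => x fx; apply: Or41; right.
Qed.

Lemma multiplicity_fill (A : set nat) :
  A `<=` upper -> multiplicity (fill A) = (F - M)%N.
Proof.
move=> AU; apply: multiplicity_eq; first by apply: Or42; exists M.
by move=> x [[|]|/lower_le|/middle_le|/AU]; rewrite /upper /=; lia.
Qed.

(** The bound f + 1 <= 3(F - M) amounts to F >= 3M + 2 + e. *)
Lemma depth_eq3 (S : set nat) :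
  frobenius S = f -> multiplicity S = (F - M)%N -> depth S = 3.
Proof. by move=> Sf Sm; rewrite /depth Sf Sm; apply: ceil_ratio_eq3; lia. Qed.

Lemma Yset_fill (A : set nat) : A `<=` upper -> Yset (fill A) = Y.
Proof.
move=> AU; rewrite /Yset frobenius_fill// fbarE; apply/seteqP; split=> t /=.
  move=> [tF [[|]|[u Yu tE]|/middle_le|/AU]]; rewrite /upper /=; try lia.
  by have := Y_le _ Yu; have -> : t = u by move: (Y_le _ Yu); lia.
move=> Yt; have tM := Y_le _ Yt; split; first by lia.
by apply: Or42; exists t.
Qed.

Lemma Zset_fill (A : set nat) : A `<=` upper -> Zset (fill A) = Z.
Proof.
move=> AU; rewrite /Zset frobenius_fill// multiplicity_fill// fbarE.
apply/seteqP; split=> [_ [x [xA x1 x2] <-]|z Zz] /=.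
  case: xA => [[|]|/lower_le|[z Zz zE]|/AU]; rewrite /upper /=; try lia.
  by have -> : (x + F - f)%N = z by lia.
have zM := Z_le _ Zz.
exists (F + 1 + e + z)%N; last by lia.
by split; [apply: Or43; exists z | lia | lia].
Qed.

Lemma semigroups_fill (A : set nat) :
  forced `<=` A -> A `<=` upper -> semigroups Y Z f (fill A).
Proof.
move=> GA AU; split; last exact: Zset_fill.
- split; [by move=> *; apply: Or41; left | exact: fill_closed|].
  apply: (finite_set_ltn _ f.+1) => x nx.
  by rewrite ltnS leqNgt; apply/negP => xf; apply: nx; apply: Or41; right.
- exact: frobenius_fill.
- exact: Yset_fill.
- by apply: depth_eq3; [exact: frobenius_fill | exact: multiplicity_fill].
Qed.

(** The order matters: Y gives the elements in [1, F], hence the multiplicity F - M, and only then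
    is the range described by Z known. *)
Lemma semigroups_structure (S : set nat) : semigroups Y Z f S ->
  forced `<=` S /\ S = fill (S `&` upper).
Proof.
move=> [[S0 Sadd _] Sf SY _ SZ].
have [Snf Sgt] : ~ S f /\ forall x, (f < x)%N -> S x.
  (* As f > 0, it is not the default of [set_max], hence really the largest gap. *)
  have f0 : (0 < set_max (~` S))%N by rewrite [set_max _]Sf; lia.
  have := set_maxP _ f0; rewrite [set_max _]Sf => -[Snf Sle].
  by split=> // x fx; apply: contrapT => /Sle; lia.
have YS t : Y t -> S (F - t)%N by rewrite -SY /Yset Sf fbarE => -[].
have SleF x : S x -> (0 < x <= F)%N -> lower x.
  move=> Sx xF; exists (F - x)%N; last by lia.
  by rewrite -SY /Yset /= Sf fbarE; split; [lia | rewrite subKn//; lia].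
have Sm : multiplicity S = (F - M)%N.
  apply: multiplicity_eq; first exact: YS.
  move=> x Sx x0; have [xF|] := leqP x F; last by lia.
  by have /lower_le/andP[] : lower x by apply: SleF; rewrite ?x0.
have ZS z : Z z -> S (F + 1 + e + z)%N.
  rewrite -SZ /Zset Sf Sm fbarE => -[x [Sx x1 x2] <-].
  by have -> : (F + 1 + e + (x + F - f))%N = x by lia.
have Smid x : S x -> (f < 2 * x)%N -> (x <= F + 1 + e + M)%N -> middle x.
  move=> Sx x1 x2; exists (x + F - f)%N; last by lia.
  rewrite -SZ /Zset Sf Sm fbarE /=; exists x => //.
  by split=> //; lia.
split=> [x [[t Yt [u Yu xE]]|[xf [t Yt [z Zz xE]]]]|].
- have -> : x = ((F - t) + (F - u))%N by have := Y_le _ Yt; have := Y_le _ Yu; lia.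
  by apply: Sadd; apply: YS.
- have -> : x = ((F - t) + (F + 1 + e + z))%N by have := Y_le _ Yt; lia.
  by apply: Sadd; [apply: YS | apply: ZS].
apply/seteqP; split=> [x Sx|x]; last first.
  by case=> [[->//|/Sgt//]|[t /YS + <-]|[z /ZS + <-]|[]].
have [x0|x0] := posnP x; first by apply: Or41; left.
have [xF|Fx] := leqP x F; first by apply: Or42; apply: SleF => //; lia.
have [xf|fx|xf] := ltngtP x f; last by case: Snf; rewrite -xf.
- have [xu|xu] := ltnP (F + 1 + e + M) x.
    by apply: Or44; split=> //; rewrite /upper /=; lia.
  (* From x > F and 2x <= f follows 2x = f, and closure under addition would put f in S. *)
  apply: Or43; apply: Smid => //; rewrite ltnNge; apply/negP => x2.
  by apply: Snf; have -> : f = (x + x)%N by [lia]; apply: Sadd.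
- by apply: Or41; right.
Qed.

(** * Parametrization by the subsets of the free positions *)

Definition free : {set 'I_f} := [set i : 'I_f | `[< (upper `\` forced) i >]]%SET.

(** The choices B are sets over the finite type ['I_f], so that finite-type counting of subsets
    applies. *)
Definition extend (B : {set 'I_f}) : set nat :=
  fill (forced `|` [set nat_of_ord i | i in [set` B]]).

Lemma finite_Y : finite_set Y.
Proof. by apply: (finite_set_ltn _ M.+1) => t /Y_le. Qed.

Lemma finite_Z : finite_set Z.
Proof. by apply: (finite_set_ltn _ M.+1) => t /Z_le. Qed.

Lemma finite_forced : finite_set forced.
Proof. by apply: (finite_set_ltn _ f) => x /forced_upper /andP[]. Qed.

Lemma freeP (B : {set 'I_f}) (i : 'I_f) :
  B \in powerset free -> i \in B -> upper i /\ ~ forced i.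
Proof.
rewrite powersetE => /fintype.subsetP Bfree /Bfree; rewrite inE.
by move=> /asboolP.
Qed.

Lemma extend_upper (B : {set 'I_f}) : B \in powerset free ->
  forced `|` [set nat_of_ord i | i in [set` B]] `<=` upper.
Proof.
move=> Bfree x [/forced_upper//|[i /= iB <-]].
by case: (freeP _ _ Bfree iB).
Qed.

Lemma semigroups_extend : semigroups Y Z f = extend @` [set` powerset free].
Proof.
apply/seteqP; split=> [S SS|_ [B Bfree <-]]; last first.
  by apply: semigroups_fill (extend_upper _ Bfree); apply: subsetUl.
have [GS ->] := semigroups_structure _ SS.
(* The choice made by S consists of its elements in [upper] that are not forced. *)
exists [set i : 'I_f | `[< (S `&` upper `\` forced) i >]]%SET.
  rewrite /= powersetE; apply/fintype.subsetP => i; rewrite !inE.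
  by move=> [[_ Ui] Gi]; split.
congr fill; apply/seteqP; split=> [x [Gx|[i /= + <-]]|x [Sx Ux]].
- by split; [apply: GS | apply: forced_upper].
- by rewrite !inE => -[].
- have [Gx|Gx] := pselect (forced x); first by left.
  have /andP[_ xf] := Ux.
  by right; exists (Ordinal xf) => //=; rewrite inE; apply/asboolP.
Qed.

(** A free position lies above [lower] and [middle] and is not forced, so it can enter [extend C]
    only through C. By symmetry this yields injectivity. *)
Lemma extend_sub (B C : {set 'I_f}) : B \in powerset free ->
  extend B = extend C -> B \subset C.
Proof.
move=> Bfree BC; apply/fintype.subsetP => i iB.
have [Ui Gi] := freeP _ _ Bfree iB.
have : extend C i by rewrite -BC; apply: Or44; right; exists i.
move: Ui; rewrite /upper /= => Ui.
case=> [|/lower_le|/middle_le|[//|[j /= jC /val_inj <-//]]]; lia.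
Qed.

Lemma extend_inj : {in [set` powerset free] &, injective extend}.
Proof.
move=> B C; rewrite !inE/= => Bfree Cfree BC; apply/eqP.
by rewrite finset.eqEsubset !extend_sub.
Qed.

(** In [1, f] the semigroup is the disjoint union of [lower], [middle], [forced] and B. The first
    two are copies of the disjoint sets Y and Z. *)
Lemma nsmall_extend (B : {set 'I_f}) : B \in powerset free ->
  nsmall (extend B) = (card_of (Y `|` Z) + card_of forced + #|B|)%N.
Proof.
move=> Bfree; have AU := extend_upper _ Bfree.
rewrite /nsmall [frobenius _]frobenius_fill//.
set V := [set nat_of_ord i | i in [set` B]] in AU *.
have finV : finite_set V by apply: finite_image.
have -> : [set x | extend B x /\ (1 <= x <= f)%N] =
    lower `|` middle `|` (forced `|` V).
  apply/seteqP; split=> [x [+ /andP[x0 xf]]|x].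
    case=> [[|]|xl|xm|xA]; try lia; [by left; left | by left; right | by right].
  case=> [[xl|xm]|xA]; split.
  - exact: Or42.
  - by have := lower_le _ xl; lia.
  - exact: Or43.
  - by have := middle_le _ xm; lia.
  - exact: Or44.
  - by have := AU _ xA; rewrite /upper /=; lia.
have finl : finite_set lower by apply/finite_image/finite_Y.
have finm : finite_set middle by apply/finite_image/finite_Z.
have finlm : finite_set (lower `|` middle) by rewrite finite_setU.
have finA : finite_set (forced `|` V).
  by rewrite finite_setU; split=> //; exact: finite_forced.
rewrite card_of_setU//; last first.
  apply/seteqP; split=> // x [xlm /AU]; rewrite /upper /=.
  by case: xlm => [/lower_le|/middle_le]; lia.
rewrite card_of_setU//; last first.
  by apply/seteqP; split=> // x [/lower_le + /middle_le]; lia.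
rewrite card_of_setU//; [|exact: finite_forced|]; last first.
  apply/seteqP; split=> // x [Gx [i /= iB ix]].
  by case: (freeP _ _ Bfree iB) => _; rewrite ix.
(* Truncated subtraction from F is injective on Y because M < F. *)
rewrite card_of_image//; [|exact: finite_Y|]; last first.
  by move=> t u; rewrite !inE => /Y_le tM /Y_le uM /=; lia.
rewrite card_of_image//; [|exact: finite_Z|]; last by move=> t u _ _ /=; lia.
rewrite card_of_image//; last by move=> i j _ _ /val_inj.
rewrite card_of_finset (card_of_setU _ Y Z) ?addnA//; [exact: finite_Y|exact: finite_Z|].
by apply/seteqP; split=> // t [/YZ].
Qed.

(** * Counting *)

Lemma card_free : (card_of forced + #|free|)%N = (F - M - 1)%N.
Proof.
have -> : #|free| = card_of (upper `\` forced).
  rewrite -card_of_finset -(@card_of_image _ _ (@nat_of_ord f))//; last first.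
    by move=> i j _ _ /val_inj.
  congr card_of; apply/seteqP; split=> [_ [i /= + <-]|x Ux].
    by rewrite inE => /asboolP.
  have [/andP[_ xf] _] := Ux.
  by exists (Ordinal xf) => //=; rewrite inE; apply/asboolP.
rewrite -card_of_setU; [|exact: finite_forced| |exact: setDIK].
  (* The forced and free positions partition [upper], of size f - (F + 1 + e + M) - 1 = F - M -
     1. *)
  by rewrite setDUK; [rewrite card_of_itv; lia | exact: forced_upper].
by apply: (finite_set_ltn _ f) => x [/andP[]].
Qed.

(** Under x |-> 2F - x the two kinds of sums become t + u and t - z - 1 - e, and x < f becomes k >
    -1 - e, which is the cutoff in [W1] or [W2]. *)
Lemma card_forced : card_of forced =
  card_of (sumset Y Y `|`
           (diffset Y Z (1 + e%:Z) `&` [set k | - e%:Z <= k])).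
Proof.
rewrite -(@card_of_image _ _ (fun x : nat => 2 * F%:Z - x%:Z)).
- congr card_of; apply/seteqP; split=> [_ [x Gx <-]|k].
    have := forced_upper _ Gx; rewrite /upper /= => Ux.
    case: Gx => [[t Yt [u Yu xE]]|[xf [t Yt [z Zz xE]]]]; [left|right].
      by exists t => //; exists u => //; lia.
    split; last by rewrite /=; lia.
    by exists t => //; exists z => //; lia.
  case=> [[t Yt [u Yu <-]]|[[t Yt [z Zz <-]] /= k0]].
    have tM := Y_le _ Yt; have uM := Y_le _ Yu.
    exists (2 * F - t - u)%N; last by lia.
    by left; exists t => //; exists u => //; lia.
  have tM := Y_le _ Yt.
  exists (f + z - t)%N; last by lia.
  by right; split; [lia | exists t => //; exists z => //; lia].
- exact: finite_forced.
- by move=> x y _ _ /=; lia.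
Qed.

Lemma card_semigroups : N_YZf Y Z f = (2 ^ #|free|)%N.
Proof.
rewrite /N_YZf semigroups_extend card_of_image ?card_of_finset ?card_powerset//.
exact: extend_inj.
Qed.

Lemma card_semigroups_nsmall (n : nat) : N_YZfn Y Z f n =
  #|[set B in powerset free |
      card_of (Y `|` Z) + card_of forced + #|B| == n]%SET|.
Proof.
rewrite /N_YZfn semigroups_extend -card_of_finset.
rewrite -(@card_of_image _ _ extend)//; last first.
  move=> B C; rewrite !inE/= !inE => /andP[Bfree _] /andP[Cfree _].
  by apply: extend_inj; rewrite inE/= powersetE.
congr card_of; apply/seteqP; split=> [_ [[B /= Bfree <-]]|_ [B /= + <-]].
  rewrite nsmall_extend// => Bn; exists B => //=.
  by rewrite inE Bfree; apply/eqP.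
rewrite inE => /andP[Bfree /eqP Bn]; split; first by exists B.
by rewrite nsmall_extend.
Qed.

Lemma count_semigroups (a : int) : a = (card_of forced)%:Z ->
  (N_YZf Y Z f)%:R = (2 : rat) ^ (F%:Z - M%:Z - 1 - a) /\
  forall n : nat, N_YZfn Y Z f n =
    binz (F%:Z - M%:Z - 1 - a)
         (n%:Z - M%:Z - 1 - a + (M%:Z + 1 - (card_of (Y `|` Z))%:Z)).
Proof.
move=> aE; have := card_free => cfree.
have -> : F%:Z - M%:Z - 1 - a = #|free| by lia.
split=> [|n]; first by rewrite card_semigroups natrX.
rewrite card_semigroups_nsmall.
set c := (card_of (Y `|` Z) + card_of forced)%N.
(* The lower index of the binomial coefficient simplifies to n - c. For n < c it is negative, so
   [binz] is 0, and no B has a negative number of elements. *)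
have [cn|nc] := leqP c n; last first.
  rewrite (_ : _ + _ = Negz (c - n).-1); last by lia.
  apply/eqP; rewrite cards_eq0; apply/eqP/finset.setP => B; rewrite !inE.
  by apply/negP => /andP[_]; lia.
rewrite (_ : _ + _ = Posz (n - c)); last by lia.
(* What remains is to count the subsets of [free] with n - c elements. *)
rewrite /= -cards_draws; apply: eq_card => B; rewrite !inE.
by congr andb; rewrite -[RHS](eqn_add2l c) subnKC.
Qed.

End Structure.

Theorem theorem4p8 (Y Z : set nat) (f : nat)
    (finY : finite_set Y) (Y0 : Y !=set0)
    (hf : (6 * set_max Y + 6 < f)%N)
    (hZ : forall z, Z z -> (z <= set_max Y)%N)
    (ZY : Z `&` Y = set0) :
  (odd f ->
     (N_YZf Y Z f)%:R
       = (2 : rat) ^ ((fbar f)%:Z - (set_max Y)%:Z - 1 - alpha Y Z)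
     /\ forall n : nat,
       N_YZfn Y Z f n
         = binz ((fbar f)%:Z - (set_max Y)%:Z - 1 - alpha Y Z)
                (n%:Z - (set_max Y)%:Z - 1 - alpha Y Z + beta Y Z))
  /\
  (~~ odd f ->
     (N_YZf Y Z f)%:R
       = (2 : rat) ^ ((fbar f)%:Z - (set_max Y)%:Z - 1 - alpha' Y Z)
     /\ forall n : nat,
       N_YZfn Y Z f n
         = binz ((fbar f)%:Z - (set_max Y)%:Z - 1 - alpha' Y Z)
                (n%:Z - (set_max Y)%:Z - 1 - alpha' Y Z + beta Y Z)).
Proof.
have [YM Y_le] := finite_set_maxP _ finY Y0.
have YZ t : Y t -> Z t -> False.
  by move=> Yt Zt; have : (Z `&` Y) t by []; rewrite ZY.
split=> fodd.
(* For odd f, e = 0, and f >= 6M + 7 gives F >= 3M + 3. *)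
- have fE : f = (2 * fbar f + 1 + 0)%N by rewrite /fbar; lia.
  apply: (count_semigroups _ _ _ _ 0 _ YM Y_le hZ YZ fE) => //; first by lia.
  by rewrite (card_forced _ _ _ _ 0 _ Y_le fE)//; lia.
(* For even f the floor gives f = 2F + 2, so e = 1; parity improves the bound to f >= 6M + 8, whence
   again F >= 3M + 3. *)
- have fE : f = (2 * fbar f + 1 + 1)%N by rewrite /fbar; lia.
  apply: (count_semigroups _ _ _ _ 1 _ YM Y_le hZ YZ fE) => //; first by lia.
  by rewrite (card_forced _ _ _ _ 1 _ Y_le fE)//; lia.
Qed.
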